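(* There exist anti-ferromagnetic parameters $(\beta,\gamma,\lambda)$ and an integer $d$ such that the two-state spin system with parameters $(\beta,\gamma,\lambda)$ has strong spatial mixing on the infinite $d$-regular tree but does not have strong spatial mixing on the family of all graphs of maximum degree at most $d$.
   Context: Two-state spin system with parameters $\beta,\gamma\ge0$, $\lambda>0$ on a finite graph $G=(V,E)$: configuration $\sigma:V\to\{0,1\}$ has weight $w(\sigma)=\prod_{(u,v)\in E}A_{\sigma(u),\sigma(v)}\prod_{v}b_{\sigma(v)}$ with $A_{0,0}=\beta$, $A_{0,1}=A_{1,0}=1$, $A_{1,1}=\gamma$, $b_0=\lambda$, $b_1=1$; Gibbs measure $\rho(\sigma)=w(\sigma)/\sum_{\sigma'}w(\sigma')$. Anti-ferromagnetic: $0\le\beta\le\gamma$, $\gamma>0$, $\beta\gamma<1$, $\lambda>0$. $p_v^{\sigma_\Lambda}$ is the Gibbs probability that $v$ has spin $0$ conditioned on the configuration on $\Lambda$ being $\sigma_\Lambda$. Strong spatial mixing on a family of finite graphs: there are constants $C,c>0$ such that for all $G$ in the family, $v\in V$, $\Lambda\subseteq V$, $\sigma_\Lambda,\tau_\Lambda\in\{0,1\}^\Lambda$, $|p_v^{\sigma_\Lambda}-p_v^{\tau_\Lambda}|\le C\exp(-c\,\mathrm{dist}_G(v,S))$, $S$ being the set where $\sigma_\Lambda,\tau_\Lambda$ differ. Strong spatial mixing on the infinite $d$-regular tree means strong spatial mixing (in this sense) on the family of finite balls (induced subtrees) of the infinite $d$-regular tree. *)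

(* Defs.v *)
From HB Require Import structures.
From mathcomp Require Import all_boot all_order all_algebra.
From mathcomp Require Import reals sequences exp.

Set Implicit Arguments.
Unset Strict Implicit.
Unset Printing Implicit Defensive.

Import Order.TTheory GRing.Theory Num.Theory.
Local Open Scope ring_scope.

Record sgraph := SGraph {
  vertex :> finType;
  adj : rel vertex;
  adj_sym : symmetric adj;
  adj_irr : irreflexive adj
}.

(* [None] stands for an infinite distance ([S] empty or unreachable from [v]).
   A shortest path has fewer than [#|G|] edges, so the bound on [n] is
   harmless. *)
Definition dist (G : sgraph) (v : G) (S : {set G}) : option nat :=
  ohead [seq n <- iota 0 #|G| |
    [exists p : n.-tuple G, path (@adj G) v p && (last v p \in S)]].

Section SpinSystem.
Variables (R : realType) (beta gamma lambda : R).

Definition antiferromagnetic : Prop :=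
  [/\ 0 <= beta, beta <= gamma, 0 < gamma, beta * gamma < 1 & 0 < lambda].

(* Spin 0 is [false] and spin 1 is [true]. *)
Definition interaction (i j : bool) : R :=
  match i, j with
  | false, false => beta
  | true, true => gamma
  | _, _ => 1
  end.

Definition local_field (i : bool) : R := if i then 1 else lambda.

Definition config (G : sgraph) := {ffun G -> bool}.

(* Each edge is counted once, oriented along the enumeration of the vertices;
   the orientation is irrelevant as [interaction] is symmetric. *)
Definition weight (G : sgraph) (s : config G) : R :=
  (\prod_(e : G * G | adj e.1 e.2 && (enum_rank e.1 < enum_rank e.2)%N)
     interaction (s e.1) (s e.2))
  * (\prod_(v : G) local_field (s v)).

Definition gibbs (G : sgraph) (s : config G) : R :=
  weight s / \sum_(t : config G) weight t.

Definition prob (G : sgraph) (E : pred (config G)) : R :=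
  \sum_(s | E s) gibbs s.

(* A configuration on [L] is represented by any extension of it to [G]. *)
Definition agree (G : sgraph) (L : {set G}) (s : config G) : pred (config G) :=
  fun t => [forall u in L, t u == s u].

Definition marginal0 (G : sgraph) (v : G) (L : {set G}) (s : config G) : R :=
  prob (fun t => agree L s t && (t v == false)) / prob (agree L s).

Definition discrepancy (G : sgraph) (L : {set G}) (s t : config G) : {set G} :=
  [set u in L | s u != t u].

(* [exp (- c * n)], with the convention [exp (- oo) = 0]. *)
Definition decay (c : R) (n : option nat) : R :=
  if n is Some k then expR (- c * k%:R) else 0.

(* The conditional probabilities are only defined for boundary conditions of
   positive probability; this is a restriction only when [beta = 0]. *)
Definition strong_spatial_mixing (F : sgraph -> Prop) : Prop :=
  exists C c : R, [/\ 0 < C, 0 < c &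
    forall G : sgraph, F G ->
    forall (v : G) (L : {set G}) (s t : config G),
      0 < prob (agree L s) -> 0 < prob (agree L t) ->
      `|marginal0 v L s - marginal0 v L t|
        <= C * decay c (dist v (discrepancy L s t))].

End SpinSystem.

Definition max_degree_le (d : nat) (G : sgraph) : Prop :=
  forall u : G, (#|[set v | adj u v]| <= d)%N.

(* The infinite d-regular tree (d >= 2) is the Cayley graph of the free product
   of d copies of Z/2: its vertices are the words over d letters without two
   equal consecutive letters, and the neighbours of a word are obtained by
   adding or deleting a first letter. The distance to the empty word is the
   length. *)
Definition reduced (d : nat) (w : seq 'I_d) : bool :=
  sorted (fun a b => a != b) w.

Definition tree_adj (d : nat) : rel (seq 'I_d) :=
  fun x y => [exists a, (y == a :: x) || (x == a :: y)].

Lemma tree_adj_sym d : symmetric (@tree_adj d).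
Proof. by move=> x y; apply: eq_existsb => a; rewrite orbC. Qed.

Lemma tree_adj_irr d : irreflexive (@tree_adj d).
Proof.
move=> x; apply/existsP => -[a]; rewrite orbb => /eqP/(congr1 size)/eqP.
by rewrite /= eqn_leq ltnn andbF.
Qed.

(* The tree is vertex-transitive (multiplication in the free product), so every
   ball of radius r is isomorphic to the one centred at the empty word. *)
Definition ball_vertex (d r : nat) : finType :=
  {w : r.-bseq 'I_d | reduced w}.

Definition ball_adj (d r : nat) : rel (ball_vertex d r) :=
  fun x y => tree_adj (val (val x)) (val (val y)).

Lemma ball_adj_sym d r : symmetric (@ball_adj d r).
Proof. by move=> x y; apply: tree_adj_sym. Qed.

Lemma ball_adj_irr d r : irreflexive (@ball_adj d r).
Proof. by move=> x; apply: tree_adj_irr. Qed.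

Definition tree_ball (d r : nat) : sgraph :=
  SGraph (@ball_adj_sym d r) (@ball_adj_irr d r).

Definition regular_tree_balls (d : nat) (G : sgraph) : Prop :=
  exists r : nat, G = tree_ball d r.

(* Main.v *)
Require Import Defs.
From mathcomp Require Import all_boot all_order all_algebra.
From mathcomp Require Import reals sequences exp.
From mathcomp Require Import ring lra.

(* If beta * gamma <= 1, a vertex v has spin 0 with conditional probability at most
   lambda / (lambda + gamma ^ deg v), whatever its neighbours are. Hence the total
   influence of the neighbours of v is at most
   deg v * lambda / (lambda + gamma ^ deg v), which is not monotone in deg v: for
   suitable parameters it is below 1 for degrees 1 and d but not in between.

   In a ball of the d-regular tree every vertex has degree d or at most 1, so
   Dobrushin's uniqueness condition holds and yields strong spatial mixing. In the
   full b-ary tree with b < d - 1 the inner vertices have the intermediate degree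
   b + 1, and the recursion for the marginal at the root exchanges two disjoint
   intervals: the constant boundary conditions on the leaves start in different
   intervals, so their influence on the root never fades. *)

Set Implicit Arguments.
Unset Strict Implicit.
Unset Printing Implicit Defensive.

Import Order.TTheory GRing.Theory Num.Theory.
Local Open Scope ring_scope.

Lemma big_option (R : Type) (idx : R) (op : Monoid.law idx) (T : finType)
    (P : pred (option T)) (F : option T -> R) :
  \big[op/idx]_(x | P x) F x =
  op (if P None then F None else idx) (\big[op/idx]_(y | P (Some y)) F (Some y)).
Proof.
rewrite ![index_enum _]unlock [@Finite.enum in LHS]unlock /= big_cons big_map.
by case: ifP; rewrite ?Monoid.mul1m.
Qed.

Definition orientation (T : finType) (e o : rel T) : Prop :=
  forall x y, e x y -> o y x = ~~ o x y.

Lemma eq_big_orientation (R : Type) (idx : R) (op : Monoid.com_law idx)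
    (T : finType) (e o1 o2 : rel T) (F : T -> T -> R) :
  symmetric e -> (forall x y, F x y = F y x) ->
  orientation e o1 -> orientation e o2 ->
  \big[op/idx]_(p | e p.1 p.2 && o1 p.1 p.2) F p.1 p.2 =
  \big[op/idx]_(p | e p.1 p.2 && o2 p.1 p.2) F p.1 p.2.
Proof.
move=> e_sym F_sym o1P o2P.
rewrite (bigID (fun p => o2 p.1 p.2)) /= [RHS](bigID (fun p => o1 p.1 p.2)) /=.
congr (op _ _); first by apply: eq_bigl => p; rewrite andbAC.
have swapK : involutive (fun p : T * T => (p.2, p.1)) by case.
rewrite (reindex_inj (inv_inj swapK)) /=.
apply: eq_big => [[x y]|[x y] _] /=; last exact: F_sym.
rewrite e_sym; case xy: (e x y) => //=.
by rewrite o1P // o2P // negbK andbC.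
Qed.

Lemma enum_rank_orientation (G : sgraph) :
  orientation (@adj G) (fun u v => enum_rank u < enum_rank v)%N.
Proof.
move=> u v uv; rewrite -leqNgt ltn_neqAle; case: eqP => //= /val_inj /enum_rank_inj vu.
by move: uv; rewrite vu adj_irr.
Qed.

(** * Graph distance and exponential decay *)

Definition graph_lipschitz (G : sgraph) (h : G -> nat) : Prop :=
  forall u v, adj u v -> (h u <= (h v).+1)%N.

Section Distance.
Variable G : sgraph.
Implicit Types (u v : G) (S : {set G}) (p : seq G) (h : G -> nat) (k n : nat).

Lemma lipschitz_path h p v : graph_lipschitz h -> path (@adj G) v p ->
  (h (last v p) <= h v + size p)%N.
Proof.
move=> h_lip; elim: p v => [|u p IH] v /=; first by rewrite addn0.
rewrite adj_sym => /andP[/h_lip uv /IH /leq_trans-> //].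
by rewrite addnS -addSn leq_add2r.
Qed.

Lemma dist_path v S k : dist v S = Some k ->
  exists p, [/\ path (@adj G) v p, last v p \in S & size p = k].
Proof.
rewrite /dist; set walks := [seq n <- _ | _] => walks_k.
have : k \in walks by case: walks walks_k => //= n l [->]; exact: mem_head.
rewrite mem_filter => /andP[/existsP[p /andP[vp pS]] _].
by exists p; rewrite size_tuple.
Qed.

Lemma dist_le v S p : path (@adj G) v p -> last v p \in S ->
  exists2 k, dist v S = Some k & (k <= size p)%N.
Proof.
case/shortenP => q vq uq qp qS; rewrite /dist; set walks := [seq n <- _ | _].
have q_walks : size q \in walks.
  rewrite mem_filter mem_iota leq0n add0n; apply/andP; split.
    by apply/existsP; exists (in_tuple q); rewrite vq.
  by have := max_card (mem (v :: q)); rewrite (card_uniqP uq).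
have : sorted ltn walks by apply: sorted_filter (iota_ltn_sorted _ _); exact: ltn_trans.
case: walks q_walks => // k l kl /(order_path_min ltn_trans)/allP k_min.
exists k => //; apply: leq_trans (uniq_leq_size _ qp); last by case/andP: uq.
by move: kl; rewrite inE => /orP[/eqP->|/k_min/ltnW].
Qed.

Lemma dist_mem v S : v \in S -> dist v S = Some 0%N.
Proof.
by move=> vS; have [//|//|k ->] := @dist_le v S [::]; rewrite leqn0 => /eqP->.
Qed.

Lemma dist_ge h n v S k : graph_lipschitz h ->
  (forall u, u \in S -> h v + n <= h u)%N -> dist v S = Some k -> (n <= k)%N.
Proof.
move=> h_lip hS /dist_path[p [vp /hS vn <-]].
by rewrite -(leq_add2l (h v)) (leq_trans vn) // lipschitz_path.
Qed.

Definition trunc_dist n S v : nat := minn n (odflt n (dist v S)).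

Lemma trunc_dist_lipschitz n S : graph_lipschitz (trunc_dist n S).
Proof.
move=> u v uv; rewrite /trunc_dist.
case vS: (dist v S) => [k|] /=; last by rewrite minnn (leq_trans (geq_minl _ _)).
have [p [vp pS pk]] := dist_path vS.
have [|//|j -> jk] := @dist_le u S (v :: p); first by rewrite /= uv.
rewrite -minnSS leq_min (leq_trans (geq_minl _ _)) //=.
by rewrite (leq_trans (geq_minr _ _)) // -pk.
Qed.

Lemma trunc_dist_mem n S v : v \in S -> trunc_dist n S v = 0%N.
Proof. by move=> /dist_mem vS; rewrite /trunc_dist vS minn0. Qed.

End Distance.

Section Decay.
Variables (R : realType) (c : R).
Hypothesis c0 : 0 < c.

Lemma expR_decay_le0 (C x : R) : 0 < C ->
  (forall n : nat, x <= C * expR (- c * n%:R)) -> x <= 0.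
Proof.
move=> C0 x_le; rewrite leNgt; apply/negP => x0.
have /archi_boundP : 0 <= C / (x * c) by rewrite divr_ge0 // ltW // mulr_gt0.
set n := Num.bound _; rewrite ltr_pdivrMr ?mulr_gt0 // => Cn.
have := x_le n; rewrite mulNr expRN ler_pdivlMr ?expR_gt0 // => xC.
have : x * (1 + c * n%:R) <= C by apply: le_trans xC; rewrite ler_pM2l // expR_ge1Dx.
nra.
Qed.

Lemma le_decay (C x : R) (d : option nat) : 0 < C ->
  (forall n, x <= C * expR (- c * (minn n (odflt n d))%:R)) -> x <= C * decay c d.
Proof.
move=> C0 x_le; case: d x_le => [k|] x_le /=; first by have := x_le k; rewrite minnn.
by rewrite mulr0; apply: (expR_decay_le0 C0) => n; have := x_le n; rewrite minnn.
Qed.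

Lemma decay_le n (d : option nat) : (forall k, d = Some k -> n <= k)%N ->
  decay c d <= expR (- c * n%:R).
Proof.
case: d => [k|] nd /=; last exact: expR_ge0.
by rewrite ler_expR !mulNr lerN2 ler_pM2l // ler_nat nd.
Qed.

End Decay.

(** * Single-site updates *)

Definition set_spin (G : sgraph) (x : config G) (v : G) (i : bool) : config G :=
  [ffun u => if u == v then i else x u].

Section SetSpin.
Variable G : sgraph.
Implicit Types (x s : config G) (u v : G) (i j : bool) (L : {set G}).

Lemma set_spinE x v i u : set_spin x v i u = if u == v then i else x u.
Proof. exact: ffunE. Qed.

Lemma set_spin_id x v : set_spin x v (x v) = x.
Proof. by apply/ffunP => u; rewrite set_spinE; case: eqP => // ->. Qed.

Lemma set_spin_set_spin x v i j : set_spin (set_spin x v i) v j = set_spin x v j.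
Proof. by apply/ffunP => u; rewrite !set_spinE; case: eqP. Qed.

Lemma set_spinC x u v i j : u != v ->
  set_spin (set_spin x u i) v j = set_spin (set_spin x v j) u i.
Proof.
move=> uv; apply/ffunP => w; rewrite !set_spinE.
by case: (w =P v) => // ->; rewrite eq_sym (negbTE uv).
Qed.

Lemma agree_set_spin L s x v i : v \notin L -> agree L s (set_spin x v i) = agree L s x.
Proof.
move=> vL; apply: eq_forallb => u; rewrite set_spinE.
by case: (u =P v) => // ->; rewrite (negbTE vL).
Qed.

Lemma sum_set_spin (V : nmodType) (P : pred (config G)) (F : config G -> V) v :
  (forall x i, P (set_spin x v i) = P x) ->
  \sum_(x | P x) F x =
  \sum_(x | P x && (x v == false)) (F (set_spin x v false) + F (set_spin x v true)).
Proof.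
move=> P_set; rewrite (bigID (fun x : config G => x v == false)) big_split /=.
congr (_ + _); first by apply: eq_bigr => x /andP[_ /eqP xv]; rewrite -xv set_spin_id.
rewrite (reindex_onto (fun x => set_spin x v true) (fun x => set_spin x v false)) /=.
  apply: eq_bigl => x; rewrite P_set set_spinE eqxx set_spin_set_spin andbT.
  congr (_ && _); apply/eqP/eqP => [<-|xv]; first by rewrite set_spinE eqxx.
  by rewrite -xv set_spin_id.
move=> x /andP[_]; rewrite eqbF_neg negbK => xv.
by rewrite set_spin_set_spin -xv set_spin_id.
Qed.

End SetSpin.

Definition degree (G : sgraph) (v : G) : nat := #|[set u | adj v u]|.

Section SpinSystem.
Variables (R : realType) (beta gamma lambda : R).
Hypotheses (beta0 : 0 <= beta) (gamma0 : 0 < gamma) (lambda0 : 0 < lambda).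
Variable G : sgraph.
Implicit Types (x s t : config G) (u v : G) (L : {set G}) (i : bool).
Implicit Types (f : config G -> R).

Local Notation A := (interaction beta gamma).
Local Notation b := (local_field lambda).
Local Notation w := (weight beta gamma lambda).
Local Notation P := (prob beta gamma lambda).

Lemma interactionC i j : A i j = A j i.
Proof. by case: i j => [] []. Qed.

Lemma interaction_ge0 i j : 0 <= A i j.
Proof. by case: i j => [] [] //=; exact: ltW. Qed.

Lemma local_field_gt0 i : 0 < b i.
Proof. by case: i. Qed.

Lemma weight_ge0 x : 0 <= w x.
Proof.
apply: mulr_ge0; apply: prodr_ge0 => *; first exact: interaction_ge0.
exact/ltW/local_field_gt0.
Qed.

Lemma weight_orientation x (o : rel G) : orientation (@adj G) o ->
  w x = (\prod_(e : G * G | adj e.1 e.2 && o e.1 e.2) A (x e.1) (x e.2))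
        * \prod_(v : G) b (x v).
Proof.
move=> oP; congr (_ * _).
apply: (@eq_big_orientation _ _ _ _ _ _ _ (fun u v => A (x u) (x v)) (@adj_sym G) _
  (@enum_rank_orientation G) oP) => u v.
exact: interactionC.
Qed.

Lemma sum_weight_gt0 : 0 < \sum_(x : config G) w x.
Proof.
rewrite (bigD1 [ffun=> true]) //= ltr_pwDl ?sumr_ge0 // => [|x _].
  by rewrite mulr_gt0 // prodr_gt0 // => *; rewrite !ffunE.
exact: weight_ge0.
Qed.

Definition spin_weight v x i : R := b i * \prod_(u | adj v u) A i (x u).

Definition rest_weight v x : R :=
  (\prod_(e : G * G | [&& adj e.1 e.2, e.1 != v, e.2 != v &
     (enum_rank e.1 < enum_rank e.2)%N]) A (x e.1) (x e.2))
  * \prod_(u | u != v) b (x u).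

Lemma weight_split v x : w x = spin_weight v x (x v) * rest_weight v x.
Proof.
pose o := [rel u u' : G | (u == v) || (u' != v) && (enum_rank u < enum_rank u')%N].
have oP : orientation (@adj G) o.
  move=> u u'; rewrite /=.
  have [->|uv] := eqVneq u v; have [->|u'v] := eqVneq u' v => //=.
  - by rewrite adj_irr.
  - exact: enum_rank_orientation.
rewrite (weight_orientation _ oP) (bigID (fun e : G * G => e.1 == v)) /=.
rewrite [\prod_u _](bigD1 v) //= mulrACA [_ * b _]mulrC; congr (_ * _ * (_ * _)).
  rewrite (eq_bigl (fun e : G * G => (e.1 == v) && adj v e.2)); last first.
    by move=> [u u'] /=; have [->|_] := eqVneq u v; rewrite ?andbF ?andbT.
  rewrite -(pair_big (pred1 v) (adj v) (fun u u' => A (x u) (x u'))) /=.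
  by rewrite big_pred1_eq.
apply: eq_bigl => -[u u'] /=.
by have [_|_] := eqVneq u v; rewrite ?andbF // andbT.
Qed.

Lemma spin_weight_set_spin v u x i j :
  ~~ adj v u -> spin_weight v (set_spin x u j) i = spin_weight v x i.
Proof.
move=> vu; congr (_ * _); apply: eq_bigr => u' vu'; rewrite set_spinE.
by case: eqP vu' => // ->; rewrite (negbTE vu).
Qed.

Lemma rest_weight_set_spin v x i : rest_weight v (set_spin x v i) = rest_weight v x.
Proof.
congr (_ * _); last by apply: eq_bigr => u /negbTE uv; rewrite set_spinE uv.
apply: eq_bigr => -[u u'] /= /and4P[_ /negbTE uv /negbTE u'v _].
by rewrite !set_spinE uv u'v.
Qed.

Lemma weight_set_spin v x i :
  w (set_spin x v i) = spin_weight v x i * rest_weight v x.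
Proof.
by rewrite (weight_split v) rest_weight_set_spin spin_weight_set_spin ?adj_irr //
  set_spinE eqxx.
Qed.

Lemma spin_weight0_ge0 v x : 0 <= spin_weight v x false.
Proof.
by apply: mulr_ge0; [exact: ltW|apply: prodr_ge0 => *; exact: interaction_ge0].
Qed.

Lemma spin_weight1_gt0 v x : 0 < spin_weight v x true.
Proof. by rewrite /spin_weight mul1r; apply: prodr_gt0 => u _ /=; case: (x u). Qed.

Definition heat_prob v x : R :=
  spin_weight v x false / (spin_weight v x false + spin_weight v x true).

Lemma heat_prob_set_spin v u x i :
  ~~ adj v u -> heat_prob v (set_spin x u i) = heat_prob v x.
Proof. by move=> vu; rewrite /heat_prob !spin_weight_set_spin. Qed.

Lemma heat_prob_itv v x : 0 <= heat_prob v x <= 1.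
Proof.
have := spin_weight1_gt0 v x; have := spin_weight0_ge0 v x => w0 w1.
by rewrite divr_ge0 ?addr_ge0 ?ler_pdivrMr ?mul1r ?lerDl ?ltr_wpDl // ltW.
Qed.

(* Each spin 0 among the neighbours multiplies the odds of spin 0 at [v] by
   [beta], each spin 1 by [1 / gamma], which is at least as large. *)
Lemma heat_prob_le v x : beta * gamma <= 1 ->
  heat_prob v x <= lambda / (lambda + gamma ^+ degree v).
Proof.
move=> bg1; rewrite ler_pdivrMr ?ltr_wpDl ?spin_weight0_ge0 ?spin_weight1_gt0 //.
rewrite mulrAC ler_pdivlMr ?addr_gt0 ?exprn_gt0 // !mulrDr [lambda * _]mulrC lerD2l.
rewrite /spin_weight /= mul1r -mulrA ler_pM2l //.
rewrite /degree cardsE -prodr_const -big_split /=.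
apply: ler_prod => u _; rewrite mulr_ge0 ?(ltW gamma0) //=; last by case: (x u).
by case: (x u); rewrite ?mul1r.
Qed.

Definition mass L s f : R := \sum_(x | agree L s x) w x * f x.

Definition cond_exp L s f : R := mass L s f / mass L s (fun=> 1).

Definition spin_indicator v i x : R := (x v == i)%:R.

Lemma mass1E L s : mass L s (fun=> 1) = \sum_(x | agree L s x) w x.
Proof. by apply: eq_bigr => x _; rewrite mulr1. Qed.

Lemma mass_indicatorE L s v i :
  mass L s (spin_indicator v i) = \sum_(x | agree L s x && (x v == i)) w x.
Proof.
rewrite big_mkcondr; apply: eq_bigr => x _; rewrite /spin_indicator.
by case: eqP => _; rewrite ?mulr1 ?mulr0.
Qed.

Lemma mass_indicatorD L s v :
  mass L s (spin_indicator v false) + mass L s (spin_indicator v true)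
  = mass L s (fun=> 1).
Proof.
rewrite !mass_indicatorE mass1E [RHS](bigID (fun x : config G => x v == false)) /=.
by congr (_ + _); apply: eq_bigl => x; case: (x v).
Qed.

Lemma prob_agree_gt0 L s : (0 < P (agree L s)) = (0 < mass L s (fun=> 1)).
Proof. by rewrite mass1E /prob -mulr_suml pmulr_lgt0 // invr_gt0 sum_weight_gt0. Qed.

Lemma marginal0E L s v :
  marginal0 beta gamma lambda v L s = cond_exp L s (spin_indicator v false).
Proof.
rewrite /cond_exp mass_indicatorE mass1E /marginal0 /prob -!mulr_suml.
by rewrite -mulf_div divff ?mulr1 // invr_neq0 // lt0r_neq0 // sum_weight_gt0.
Qed.

Definition heat_bath v f x : R :=
  heat_prob v x * f (set_spin x v false) + (1 - heat_prob v x) * f (set_spin x v true).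

Lemma mass_heat_bath L s v f : v \notin L -> mass L s (heat_bath v f) = mass L s f.
Proof.
move=> vL; rewrite /mass.
rewrite !(sum_set_spin (v := v) _ (fun x i => agree_set_spin s x i vL)).
apply: eq_bigr => x _; rewrite /heat_bath !heat_prob_set_spin ?adj_irr //.
rewrite !set_spin_set_spin !weight_set_spin /heat_prob.
have := ltr_wpDl (spin_weight0_ge0 v x) (spin_weight1_gt0 v x).
by move: (spin_weight v x) => S /lt0r_neq0 S0; field.
Qed.

Lemma norm_cond_exp_sub_le L s f c M : 0 < mass L s (fun=> 1) ->
  (forall x, agree L s x -> `|f x - c| <= M) -> `|cond_exp L s f - c| <= M.
Proof.
move=> m0 fM; have -> : cond_exp L s f - c
    = (\sum_(x | agree L s x) w x * (f x - c)) / mass L s (fun=> 1).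
  rewrite /cond_exp -[X in _ - X](mulfK (lt0r_neq0 m0)) -mulrBl mulr_sumr -sumrB.
  by congr (_ / _); apply: eq_bigr => x _; rewrite mulr1 [c * _]mulrC mulrBr.
rewrite normrM normfV (gtr0_norm m0) ler_pdivrMr // mulr_sumr.
apply: le_trans (ler_norm_sum _ _ _) _; apply: ler_sum => x xL.
by rewrite normrM (ger0_norm (weight_ge0 x)) mulr1 mulrC ler_wpM2r ?weight_ge0 ?fM.
Qed.

(** * Dobrushin's comparison theorem *)

Definition osc f u : R :=
  \big[Num.max/0]_x `|f (set_spin x u false) - f (set_spin x u true)|.

Lemma osc_ge0 f u : 0 <= osc f u.
Proof. exact: bigmax_ge_id. Qed.

Lemma osc_le f u M : 0 <= M ->
  (forall x, `|f (set_spin x u false) - f (set_spin x u true)| <= M) -> osc f u <= M.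
Proof. by move=> M0 fM; apply: bigmax_le. Qed.

Lemma le_osc f u x i j : `|f (set_spin x u i) - f (set_spin x u j)| <= osc f u.
Proof.
have flip : `|f (set_spin x u false) - f (set_spin x u true)| <= osc f u.
  exact: (le_bigmax _ (fun x => `|f (set_spin x u false) - f (set_spin x u true)|)).
by case: i; case: j; rewrite ?subrr ?normr0 ?osc_ge0 // distrC.
Qed.

Lemma norm_sub_le_sum_osc f x y : `|f x - f y| <= \sum_u osc f u.
Proof.
suff telescope (l : seq G) (z : config G) : (forall u, u \notin l -> z u = y u) ->
    `|f z - f y| <= \sum_(u <- l) osc f u.
  by apply: telescope => u; rewrite mem_index_enum.
elim: l z => [|u l IH] z zy.
  have -> : z = y by apply/ffunP => u; exact: zy.
  by rewrite subrr normr0 big_nil.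
rewrite big_cons; apply: le_trans (ler_distD (f (set_spin z u (y u))) _ _) _.
apply: lerD; first by rewrite -{1}(set_spin_id z u) le_osc.
apply: IH => u' u'l; rewrite set_spinE; case: eqP => [->//|/eqP u'u].
by apply: zy; rewrite inE negb_or u'u.
Qed.

Lemma osc_indicator v u : osc (spin_indicator v false) u <= (u == v)%:R.
Proof.
apply: osc_le => // x; rewrite /spin_indicator !set_spinE [u == v]eq_sym.
by case: (v =P u) => _; rewrite /= ?subrr ?subr0 ?normr0 ?normr1.
Qed.

Definition influence v u : R := osc (heat_prob v) u.

Lemma influence_nonadj v u : ~~ adj v u -> influence v u = 0.
Proof.
move=> vu; apply/le_anti; rewrite osc_ge0 andbT osc_le // => x.
by rewrite !heat_prob_set_spin // subrr normr0.
Qed.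

Lemma influence_le v u M : (forall x, heat_prob v x <= M) -> influence v u <= M.
Proof.
move=> pM; apply: osc_le => [|x].
  by have /andP[/le_trans-> //] := heat_prob_itv v [ffun=> false].
have := heat_prob_itv v (set_spin x u false).
have := heat_prob_itv v (set_spin x u true).
have := pM (set_spin x u false); have := pM (set_spin x u true).
by rewrite ler_norml; lra.
Qed.

Lemma sum_influence_le v : beta * gamma <= 1 ->
  \sum_u influence v u <= (degree v)%:R * (lambda / (lambda + gamma ^+ degree v)).
Proof.
move=> bg1; rewrite (bigID (adj v)) /= [X in _ + X]big1 => [|u]; last first.
  exact: influence_nonadj.
apply: le_trans (_ : \sum_(u | adj v u) lambda / (lambda + gamma ^+ degree v) <= _).
  rewrite addr0; apply: ler_sum => u _; apply: influence_le => x.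
  exact: heat_prob_le.
by rewrite sumr_const /degree cardsE mulr_natl.
Qed.

Lemma osc_heat_bath f v u :
  osc (heat_bath v f) u <= if u == v then 0 else osc f u + influence v u * osc f v.
Proof.
have [->|uv] := eqVneq u v; apply: osc_le => //.
- move=> x; rewrite /heat_bath !heat_prob_set_spin ?adj_irr //.
  by rewrite !set_spin_set_spin subrr normr0.
- by rewrite addr_ge0 ?mulr_ge0 ?osc_ge0.
move=> x; rewrite /heat_bath !(set_spinC _ _ _ uv).
have := le_osc (heat_prob v) u x false true; rewrite -/(influence v u).
have := heat_prob_itv v (set_spin x u false).
set p := heat_prob v _; set q := heat_prob v _ => /andP[p0 p1] pq.
pose g i j := f (set_spin (set_spin x v i) u j); rewrite -!/(g _ _).
have -> : p * g false false + (1 - p) * g true false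
      - (q * g false true + (1 - q) * g true true)
    = (p * (g false false - g false true) + (1 - p) * (g true false - g true true))
      + (p - q) * (g false true - g true true) by ring.
apply: le_trans (ler_normD _ _) _; apply: lerD; last first.
  by rewrite normrM ler_pM // /g -!(set_spinC _ _ _ uv) le_osc.
have -> : osc f u = p * osc f u + (1 - p) * osc f u by ring.
apply: le_trans (ler_normD _ _) _.
rewrite (normrM p) (normrM (1 - p)) (ger0_norm p0) [`|1 - p|]ger0_norm ?subr_ge0 //.
by apply: lerD; rewrite ler_wpM2l ?subr_ge0 //; exact: le_osc.
Qed.

Section Comparison.
Variables (L : {set G}) (s t : config G).
Hypotheses (s_gt0 : 0 < P (agree L s)) (t_gt0 : 0 < P (agree L t)).

(* An estimate in the sense of Dobrushin's comparison theorem: [a u] bounds how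
   much the two conditional measures differ at [u]. *)
Definition estimate (a : G -> R) : Prop := forall f,
  `|cond_exp L s f - cond_exp L t f| <= \sum_u a u * osc f u.

Lemma estimate_const1 : estimate (fun=> 1).
Proof.
move=> f; under eq_bigr do rewrite mul1r.
apply: norm_cond_exp_sub_le => [|x _]; first by rewrite -prob_agree_gt0.
rewrite distrC; apply: norm_cond_exp_sub_le => [|y _]; first by rewrite -prob_agree_gt0.
exact: norm_sub_le_sum_osc.
Qed.

Lemma le_estimate a a' : (forall u, a u <= a' u) -> estimate a -> estimate a'.
Proof.
move=> aa' a_est f; apply: le_trans (a_est f) _.
by apply: ler_sum => u _; rewrite ler_wpM2r ?osc_ge0.
Qed.

Lemma estimate_pinned a v : (forall u, 0 <= a u) -> v \in L -> s v = t v ->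
  estimate a -> estimate (fun u => if u == v then 0 else a u).
Proof.
move=> a0 vL st a_est f; pose g x := f (set_spin x v (s v)).
have pinned (r : config G) : r v = s v -> cond_exp L r f = cond_exp L r g.
  move=> rs; congr (_ / _); apply: eq_bigr => x /forall_inP/(_ v vL)/eqP xr.
  by rewrite /g -rs -xr set_spin_id.
rewrite !pinned //; apply: le_trans (a_est g) _; apply: ler_sum => u _.
have [->|uv] := eqVneq u v.
  rewrite mul0r mulr_ge0_le0 // osc_le // => x.
  by rewrite /g !set_spin_set_spin subrr normr0.
rewrite ler_wpM2l // osc_le ?osc_ge0 // => x.
by rewrite /g !(set_spinC _ _ _ uv) le_osc.
Qed.

Lemma estimate_heat_bath a v : (forall u, 0 <= a u) -> v \notin L -> estimate a ->
  estimate (fun u => if u == v then \sum_u' influence v u' * a u' else a u).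
Proof.
move=> a0 vL a_est f.
rewrite /cond_exp -!(mass_heat_bath _ f vL) -!/(cond_exp _ _ _).
apply: le_trans (a_est _) _.
apply: le_trans (ler_sum _ (fun u _ => ler_wpM2l (a0 u) (osc_heat_bath f v u))) _.
rewrite (bigD1 v) //= [leRHS](bigD1 v) //= eqxx mulr0 add0r.
rewrite [\sum_u' _](bigD1 v) //= influence_nonadj ?adj_irr // mul0r add0r.
rewrite mulr_suml -big_split /=; apply: ler_sum => u /negbTE->.
by rewrite mulrDr addrC mulrCA mulrA lexx.
Qed.

Variables (alpha : R) (h : G -> nat).
Hypotheses (alpha0 : 0 <= alpha) (alpha1 : alpha <= 1).
Hypothesis dobrushin : forall v, \sum_u influence v u <= alpha.
Hypotheses (h_lip : graph_lipschitz h)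
  (h_disc : forall u, u \in discrepancy L s t -> h u = 0%N).

Lemma estimate_update k v a :
  (forall u, 0 <= a u <= alpha ^+ minn k (h u)) -> estimate a ->
  estimate (fun u => if u == v then alpha ^+ minn k.+1 (h v) else a u).
Proof.
move=> a_itv a_est; have a0 u : 0 <= a u by case/andP: (a_itv u).
have [hv0|hv] := posnP (h v).
  apply: le_estimate a_est => u; case: eqP => // ->.
  by have /andP[_] := a_itv v; rewrite hv0 !minn0.
have [vL|vL] := boolP (v \in L).
  have st : s v = t v.
    by apply/eqP; apply: contraTT hv => st; rewrite -leqNgt h_disc // inE vL.
  apply: le_estimate (estimate_pinned a0 vL st a_est) => u.
  by case: eqP; rewrite ?exprn_ge0.
apply: le_estimate (estimate_heat_bath a0 vL a_est) => u; case: eqP => // _.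
rewrite -{1}(prednK hv) minnSS exprS.
apply: le_trans (ler_wpM2r (exprn_ge0 _ alpha0) (dobrushin v)).
rewrite mulr_suml; apply: ler_sum => u' _.
have [vu'|/influence_nonadj->] := boolP (adj v u'); last by rewrite !mul0r.
rewrite ler_wpM2l ?osc_ge0 //; have /andP[_ /le_trans-> //] := a_itv u'.
rewrite ler_wiXn2l // leq_min geq_minl (leq_trans (geq_minr _ _)) //.
by rewrite -ltnS prednK // h_lip.
Qed.

(* Each sweep of updates over all vertices gains a factor [alpha] wherever the
   discrepancy is further away than the number of sweeps. *)
Lemma estimate_power k : estimate (fun u => alpha ^+ minn k (h u)).
Proof.
elim: k => [|k IH]; first by apply: le_estimate estimate_const1 => u; rewrite min0n.
pose swept (l : seq G) u := alpha ^+ minn (if u \in l then k.+1 else k) (h u).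
suff sweep l : estimate (swept l).
  by apply: le_estimate (sweep (enum G)) => u; rewrite /swept mem_enum.
elim: l => [//|v l IHl].
have swept_itv u : 0 <= swept l u <= alpha ^+ minn k (h u).
  rewrite exprn_ge0 //= ler_wiXn2l // leq_min geq_minr andbT.
  by rewrite (leq_trans (geq_minl _ _)) //; case: ifP.
apply: le_estimate (estimate_update v swept_itv IHl) => u; rewrite /swept inE.
by case: eqP => [->|].
Qed.

Lemma marginal0_diff_le v :
  `|marginal0 beta gamma lambda v L s - marginal0 beta gamma lambda v L t|
    <= alpha ^+ h v.
Proof.
rewrite !marginal0E; apply: le_trans (estimate_power (h v) _) _.
rewrite (bigD1 v) //= big1 => [|u /negbTE uv].
  rewrite minnn addr0 ler_piMr ?exprn_ge0 //.
  by have := osc_indicator v v; rewrite eqxx.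
suff -> : osc (spin_indicator v false) u = 0 by rewrite mulr0.
by apply/le_anti; have := osc_indicator v u; rewrite uv osc_ge0 andbT.
Qed.

End Comparison.
End SpinSystem.

Theorem dobrushin_strong_spatial_mixing (R : realType) (beta gamma lambda alpha : R)
    (F : sgraph -> Prop) :
  0 <= beta -> 0 < gamma -> 0 < lambda -> 0 < alpha < 1 ->
  (forall G, F G -> forall v : G, \sum_u influence beta gamma lambda v u <= alpha) ->
  strong_spatial_mixing beta gamma lambda F.
Proof.
move=> beta0 gamma0 lambda0 /andP[alpha0 alpha1] F_dobrushin.
have c0 : 0 < - ln alpha by rewrite oppr_gt0 ln_lt0 // alpha0.
exists 1, (- ln alpha); split=> // G FG v L s t s_gt0 t_gt0.
apply: le_decay => // n; rewrite opprK expRM_natr lnK ?posrE // mul1r.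
apply: (marginal0_diff_le (h := trunc_dist n (discrepancy L s t)) beta0 gamma0 lambda0
  s_gt0 t_gt0 (ltW alpha0) (ltW alpha1) (F_dobrushin G FG)) => [|u].
  exact: trunc_dist_lipschitz.
exact: trunc_dist_mem.
Qed.

(** * Balls of the regular tree *)

Section LetterMul.
Variable d : nat.
Implicit Types (a : 'I_d) (x y : seq 'I_d).

Definition letter_mul a x : seq 'I_d :=
  if x is b :: x' then if a == b then x' else a :: x else [:: a].

Lemma letter_mul_reduced a x : reduced x -> reduced (letter_mul a x).
Proof.
case: x => [//|b x] /=; case: eqP => [_|/eqP ab] /=; last by rewrite /reduced /= ab.
exact: path_sorted.
Qed.

Lemma size_letter_mul a x : (size (letter_mul a x) <= (size x).+1)%N.
Proof. by case: x => [//|b x] /=; case: eqP => //= _; rewrite ltnW // ltnW. Qed.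

Lemma letter_mul_inj x : injective (letter_mul^~ x).
Proof.
case: x => [|b x] a a' /=; first by case.
case: eqP => [->|_]; case: eqP => [->|_] //; last by case.
- by move/(congr1 size)/eqP; rewrite /= eqn_leq [X in _ && X]ltnNge leqnSn andbF.
- by move/(congr1 size)/eqP; rewrite /= eqn_leq ltnNge leqnSn.
Qed.

Lemma tree_adjE x y : reduced y -> tree_adj x y = [exists a, y == letter_mul a x].
Proof.
move=> y_red; apply/existsP/existsP => -[a].
  case/orP => /eqP xy; exists a; last by rewrite xy /= eqxx.
  by move: y_red; rewrite xy; case: x {xy} => //= b x /andP[/negbTE-> _].
case: x => [|b x] /= => [/eqP->|]; first by exists a; rewrite eqxx.
case: (a =P b) => _ /eqP->; last by exists a; rewrite eqxx.
by exists b; rewrite eqxx orbT.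
Qed.

End LetterMul.

Section BallDegree.
Variables d r : nat.
Implicit Types x y : tree_ball d r.

Definition word x : seq 'I_d := val (val x).

Lemma word_inj : injective word.
Proof. by move=> x y /val_inj/val_inj. Qed.

Lemma size_word x : (size (word x) <= r)%N.
Proof. exact: size_bseq. Qed.

Lemma exists_word (w : seq 'I_d) :
  reduced w -> (size w <= r)%N -> exists x, word x == w.
Proof.
by move=> w_red w_size; exists (Sub (Bseq w_size) w_red); rewrite /word !SubK.
Qed.

Lemma tree_ball_adjE x y : adj x y = [exists a, word y == letter_mul a (word x)].
Proof. exact: tree_adjE (valP y). Qed.

Lemma degree_inner x : (size (word x) < r)%N -> degree x = d.
Proof.
move=> x_lt.
have neighbour a : exists y, word y == letter_mul a (word x).
  apply: exists_word; first exact/letter_mul_reduced/(valP x).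
  exact: leq_trans (size_letter_mul _ _) x_lt.
pose f a := xchoose (neighbour a).
have word_f a : word (f a) = letter_mul a (word x).
  exact/eqP/(xchooseP (neighbour a)).
have -> : degree x = #|f @: [set: 'I_d]|.
  apply: eq_card => y; rewrite inE tree_ball_adjE.
  apply/existsP/imsetP => -[a]; last by move=> _ ->; exists a; exact/eqP/word_f.
  by move=> /eqP ya; exists a => //; apply: word_inj; rewrite word_f.
rewrite card_imset ?cardsT ?card_ord // => a a' /(congr1 word).
by rewrite !word_f => /letter_mul_inj.
Qed.

Lemma degree_boundary x : size (word x) = r -> (degree x <= 1)%N.
Proof.
move=> x_size; have parent y : adj x y -> exists a, word x = a :: word y.
  case/existsP=> a /orP[]/eqP xy; last by exists a.
  by have := size_word y; rewrite [word y]xy /= [size _]x_size ltnn.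
apply/card_le1_eqP => y z; rewrite !inE => /parent[a ya] /parent[a' za].
by apply: word_inj; move: ya; rewrite za => -[].
Qed.

Lemma degree_tree_ball x : degree x = d \/ (degree x <= 1)%N.
Proof.
have := size_word x; rewrite leq_eqVlt.
by case/orP => [/eqP/degree_boundary|/degree_inner]; [right|left].
Qed.

End BallDegree.

Theorem regular_tree_mixing (R : realType) (beta gamma lambda : R) (d : nat) :
  antiferromagnetic beta gamma lambda -> d%:R * lambda < lambda + gamma ^+ d ->
  strong_spatial_mixing beta gamma lambda (regular_tree_balls d).
Proof.
case=> beta0 _ gamma0 /ltW bg1 lambda0 d_lt.
have sum_gt0 k : 0 < lambda + gamma ^+ k by rewrite addr_gt0 // exprn_gt0.
pose bound k : R := k%:R * (lambda / (lambda + gamma ^+ k)).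
have [bound1 boundd] : bound 1%N < 1 /\ bound d < 1.
  by rewrite /bound !mulrA !ltr_pdivrMr // !mul1r ltrDl exprn_gt0.
apply: (@dobrushin_strong_spatial_mixing _ _ _ _ (Num.max (bound 1%N) (bound d))) => //.
  by rewrite lt_max gt_max bound1 boundd /bound mul1r divr_gt0.
move=> G [r ->] v; apply: le_trans (sum_influence_le _ _ _ _ bg1) _ => //.
rewrite -/(bound _) le_max; case: (degree_tree_ball v) => [->|].
  by rewrite lexx orbT.
case: (degree v) => [_|[_|//]]; last by rewrite lexx.
by rewrite /bound mul0r mulr_ge0 // divr_ge0 // ltW.
Qed.

(** * Recursion on full trees *)

(* [depth] need only be a lower bound for the distance to the root. *)
Record rooted_graph := RootedGraph {
  graph :> sgraph;
  root : graph;
  depth : graph -> nat;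
  depth_root : depth root = 0%N;
  depth_lipschitz : graph_lipschitz depth
}.

Definition level (T : rooted_graph) (n : nat) : {set T} := [set x | depth x == n].

Lemma dist_root_level (T : rooted_graph) n (S : {set T}) k :
  S \subset level T n -> dist (root T) S = Some k -> (n <= k)%N.
Proof.
move=> /subsetP Sn; apply: dist_ge (@depth_lipschitz T) _ => x /Sn.
by rewrite inE depth_root => /eqP->.
Qed.

Definition point_graph : sgraph :=
  @SGraph unit (fun _ _ => false) (fun _ _ => erefl) (fun _ => erefl).

Lemma point_graph_lipschitz : @graph_lipschitz point_graph (fun=> 0%N).
Proof. by []. Qed.

Definition rooted_point : rooted_graph :=
  @RootedGraph point_graph tt (fun=> 0%N) erefl point_graph_lipschitz.

(* A new root [None], joined to the roots of copies of [T] indexed by [I]. *)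
Section Graft.
Variables (I : finType) (T : rooted_graph).

Definition graft_adj : rel (option (I * T)) := fun x y =>
  match x, y with
  | None, Some (_, a) | Some (_, a), None => a == root T
  | Some (k, a), Some (l, b) => (k == l) && adj a b
  | None, None => false
  end.

Lemma graft_adj_sym : symmetric graft_adj.
Proof. by move=> [[k a]|] [[l b]|] //=; rewrite eq_sym adj_sym. Qed.

Lemma graft_adj_irr : irreflexive graft_adj.
Proof. by move=> [[k a]|] //=; rewrite adj_irr andbF. Qed.

Definition graft_graph : sgraph := SGraph graft_adj_sym graft_adj_irr.

Definition graft_depth (x : graft_graph) : nat :=
  if x is Some (_, a) then (depth a).+1 else 0%N.

Lemma graft_depth_lipschitz : graph_lipschitz graft_depth.
Proof.
move=> [[k a]|] [[l b]|] //=; first by move=> /andP[_ /depth_lipschitz].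
by move=> /eqP->; rewrite depth_root.
Qed.

Definition graft : rooted_graph :=
  @RootedGraph graft_graph None graft_depth erefl graft_depth_lipschitz.

Section BigAdj.
Variables (V : Type) (idx : V) (op : Monoid.com_law idx).

Lemma big_adj_root (F : graft -> V) :
  \big[op/idx]_(x | adj (root graft) x) F x = \big[op/idx]_k F (Some (k, root T)).
Proof.
rewrite big_option /= Monoid.mul1m.
rewrite (eq_big (fun y => true && pred1 (root T) y.2) (fun y => F (Some (y.1, y.2))));
  [|by case|by case].
rewrite -(pair_big xpredT (pred1 (root T)) (fun k a => F (Some (k, a)))) /=.
by under eq_bigr do rewrite big_pred1_eq.
Qed.

Lemma big_adj_copy k a (P : pred graft) (F : graft -> V) :
  \big[op/idx]_(x | adj (Some (k, a) : graft) x && P x) F x =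
  op (if (a == root T) && P None then F None else idx)
     (\big[op/idx]_(a' | adj a a' && P (Some (k, a'))) F (Some (k, a'))).
Proof.
rewrite big_option /=; congr (op _ _).
pose Q l a' := adj a a' && P (Some (l, a')).
rewrite (eq_big (fun y => pred1 k y.1 && Q y.1 y.2) (fun y => F (Some (y.1, y.2))));
  [|by case=> l a'; rewrite /= eq_sym andbA|by case].
by rewrite -(pair_big_dep (pred1 k) Q (fun l a' => F (Some (l, a')))) /= big_pred1_eq.
Qed.

End BigAdj.

Lemma degree_graft (x : graft) :
  degree x = if x is Some (_, a) then ((a == root T) + degree a)%N else #|I|.
Proof.
rewrite /degree -sum1dep_card; case: x => [[k a]|]; last first.
  by rewrite big_adj_root sum1_card.
under eq_bigl do rewrite -[adj _ _]andbT.
rewrite (big_adj_copy _ _ _ xpredT) andbT -sum1dep_card; congr (_ + _)%N.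
by apply: eq_bigl => a'; rewrite andbT.
Qed.

Definition paste (i : bool) (f : {ffun I -> config T}) : config graft :=
  [ffun x => if x is Some (k, a) then f k a else i].

Lemma agree_level_paste n i j (f : {ffun I -> config T}) :
  agree (level graft n.+1) [ffun=> j] (paste i f) =
  [forall k, agree (level T n) [ffun=> j] (f k)].
Proof.
apply/forall_inP/forallP => [agr k|agr [[k a]|]]; last by rewrite inE.
  apply/forall_inP => a an; have := agr (Some (k, a)).
  by rewrite !ffunE; apply; move: an; rewrite !inE.
rewrite !ffunE inE eqSS => an; have /forall_inP/(_ a) := agr k.
by rewrite ffunE; apply; rewrite inE.
Qed.

Variables (R : realType) (beta gamma lambda : R).
Local Notation A := (interaction beta gamma).
Local Notation b := (local_field lambda).
Local Notation w := (weight beta gamma lambda).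

(* Edges of [graft] point away from the root, and inside a copy of [T] along the
   enumeration of [T]. *)
Definition graft_order : rel graft := fun x y : option (I * T) =>
  match x, y with
  | None, _ => true
  | Some (_, a), Some (_, a') => (enum_rank a < enum_rank a')%N
  | Some _, None => false
  end.

Lemma graft_order_orientation : orientation (@adj graft) graft_order.
Proof. by move=> [[k a]|] [[l a']|] //= /andP[_ /enum_rank_orientation]. Qed.

Lemma weight_paste i (f : {ffun I -> config T}) :
  w (paste i f) = b i * \prod_k (A i (f k (root T)) * w (f k)).
Proof.
pose edge x y := A (paste i f x) (paste i f y).
have root_edges : \prod_(y | adj (root graft) y && graft_order None y) edge None y
    = \prod_k A i (f k (root T)).
  under eq_bigl do rewrite andbT.
  by rewrite big_adj_root; apply: eq_bigr => k _; rewrite /edge !ffunE.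
have copy_edges (p : I * T) :
    \prod_(y | adj (Some p : graft) y && graft_order (Some p) y) edge (Some p) y
    = \prod_(a | adj p.2 a && (enum_rank p.2 < enum_rank a)%N) A (f p.1 p.2) (f p.1 a).
  case: p => k a; rewrite big_adj_copy andbF /= mul1r.
  by apply: eq_bigr => a' _; rewrite /edge !ffunE.
rewrite (weight_orientation _ _ _ _ graft_order_orientation).
rewrite -(pair_big_dep xpredT (fun x y => adj x y && graft_order x y) edge).
rewrite big_option [\prod_v _]big_option root_edges /=.
rewrite (eq_bigr _ (fun p _ => copy_edges p)) ffunE mulrCA -mulrA.
rewrite big_split; congr (_ * (_ * _)).
rewrite [\prod_y b _](eq_bigr (fun p => b (f p.1 p.2))) => [|[k a] _]; last first.
  by rewrite ffunE.
rewrite -(pair_bigA _ (fun k a =>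
  \prod_(a' | adj a a' && (enum_rank a < enum_rank a')%N) A (f k a) (f k a'))).
rewrite -(pair_bigA _ (fun k a => b (f k a))) -big_split; apply: eq_bigr => k _.
by rewrite pair_big_dep.
Qed.

End Graft.

Definition root_weight (R : realType) (beta gamma lambda : R) (T : rooted_graph)
    (n : nat) (j i : bool) : R :=
  mass beta gamma lambda (level T n) [ffun=> j] (spin_indicator R (root T) i).

Section RootWeight.
Variables (R : realType) (beta gamma lambda : R).
Local Notation A := (interaction beta gamma).
Local Notation b := (local_field lambda).
Local Notation Z := (root_weight beta gamma lambda).

Lemma root_weight_point j i : Z rooted_point 0 j i = if i == j then b i else 0.
Proof.
have agreeE (x : config rooted_point) :
    agree (level rooted_point 0) [ffun=> j] x = (x tt == j).
  apply/forall_inP/eqP => [/(_ tt)|xj []]; rewrite !ffunE ?xj // inE eqxx.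
  by move/(_ isT)/eqP.
rewrite /root_weight mass_indicatorE.
under eq_bigl do rewrite agreeE.
have [->|/negbTE ij] := eqVneq i j; last first.
  by rewrite big_pred0 // => x; case: eqP => //= ->; rewrite eq_sym.
rewrite (big_pred1 [ffun=> j]) => [|x]; last first.
  by rewrite andbb; apply/eqP/eqP => [xj|->]; [apply/ffunP => -[]|]; rewrite ffunE.
rewrite /weight [X in X * _]big_pred0 ?mul1r => [|[[] []]] //.
by rewrite (big_pred1 tt) ?ffunE // => -[].
Qed.

Lemma root_weight_graft (I : finType) (T : rooted_graph) n j i :
  Z (graft I T) n.+1 j i
  = b i * (A i false * Z T n j false + A i true * Z T n j true) ^+ #|I|.
Proof.
pose boundary := agree (level T n) [ffun=> j].
have -> : A i false * Z T n j false + A i true * Z T n j true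
    = \sum_(x | boundary x) A i (x (root T)) * weight beta gamma lambda x.
  rewrite /root_weight !mulr_sumr -big_split; apply: eq_bigr => x _.
  by rewrite /spin_indicator; case: (x _); rewrite /= ?mulr1 ?mulr0 ?addr0 ?add0r.
rewrite -prodr_const bigA_distr_big mulr_sumr /root_weight mass_indicatorE.
rewrite (reindex_onto (@paste I T i)
  (fun x => [ffun k => [ffun a => x (Some (k, a))]])) /=.
  apply: eq_big => f; last by rewrite weight_paste.
  rewrite agree_level_paste ffunE eqxx andbT; apply/andP/ffun_onP => [[/forallP//]|fP].
  by split; [exact/forallP|apply/eqP/ffunP => k; apply/ffunP => a; rewrite !ffunE].
by move=> x /andP[_ /eqP xi]; apply/ffunP => -[[k a]|]; rewrite !ffunE.
Qed.

Hypotheses (beta0 : 0 <= beta) (gamma0 : 0 < gamma) (lambda0 : 0 < lambda).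

Lemma prob_level_gt0 T n j :
  (0 < prob beta gamma lambda (agree (level T n) [ffun=> j]))
  = (0 < Z T n j false + Z T n j true).
Proof. by rewrite prob_agree_gt0 // -(mass_indicatorD _ _ _ _ _ (root T)). Qed.

Lemma marginal0_root T n j :
  marginal0 beta gamma lambda (root T) (level T n) [ffun=> j]
  = Z T n j false / (Z T n j false + Z T n j true).
Proof. by rewrite marginal0E // /cond_exp -(mass_indicatorD _ _ _ _ _ (root T)). Qed.

End RootWeight.

Definition full_tree (b n : nat) : rooted_graph := iter n (graft 'I_b) rooted_point.

Lemma degree_full_tree b n : (degree (root (full_tree b n)) <= b)%N /\
  max_degree_le b.+1 (full_tree b n).
Proof.
elim: n => [|n [IHroot IH]].
  by split=> [|u]; rewrite /degree -sum1dep_card big_pred0.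
split=> [|u]; first by rewrite degree_graft card_ord.
rewrite -/(degree u) degree_graft; case: u => [[k a]|]; last by rewrite card_ord.
by have [->|_] := eqVneq a; [rewrite add1n ltnS|exact: IH].
Qed.

Lemma exprn_cross_le (R : realDomainType) (a c x y k l : R) (n : nat) :
  0 <= a -> 0 < c -> 0 <= x -> 0 <= l -> a * x <= c * y ->
  k * c ^+ n <= l * a ^+ n -> k * x ^+ n <= l * y ^+ n.
Proof.
move=> a0 c0 x0 l0 ax_le kc_le; rewrite -(ler_pM2r (exprn_gt0 n c0)) mulrAC.
apply: le_trans (ler_wpM2r (exprn_ge0 n x0) kc_le) _.
rewrite -!mulrA -!exprMn [y * c]mulrC ler_wpM2l // lerXn2r ?nnegrE //.
  exact: mulr_ge0.
exact: le_trans (mulr_ge0 a0 x0) ax_le.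
Qed.

(* With [z0], [z1] the weights of the two root spins, grafting [b] copies maps the
   ratio [r = z0 / z1] to [lambda * ((beta * r + 1) / (r + gamma)) ^ b], which is
   decreasing in [r] since [beta * gamma < 1]. The last two hypotheses say that it
   exchanges the intervals [0 <= r <= p] and [q <= r]. *)
Section Phases.
Variables (R : realType) (beta gamma lambda p q : R) (b : nat).
Hypothesis antiferro : antiferromagnetic beta gamma lambda.
Hypotheses (p0 : 0 <= p) (pq : p < q).
Hypothesis low_high : q * (p + gamma) ^+ b <= lambda * (beta * p + 1) ^+ b.
Hypothesis high_low : lambda * (beta * q + 1) ^+ b <= p * (q + gamma) ^+ b.

Definition low_phase (z0 z1 : R) : Prop := [/\ 0 <= z0, 0 < z1 & z0 <= p * z1].
Definition high_phase (z0 z1 : R) : Prop := [/\ 0 < z0, 0 <= z1 & q * z1 <= z0].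

Lemma ratio_cross r z0 z1 :
  (beta * r + 1) * (z0 + gamma * z1) - (r + gamma) * (beta * z0 + z1)
  = (1 - beta * gamma) * (z0 - r * z1).
Proof. by ring. Qed.

Lemma low_to_high z0 z1 : low_phase z0 z1 ->
  high_phase (lambda * (beta * z0 + z1) ^+ b) ((z0 + gamma * z1) ^+ b).
Proof.
case: antiferro => beta0 _ gamma0 bg1 lambda0 [z00 z10 zp].
have x0 : 0 <= z0 + gamma * z1 by rewrite addr_ge0 ?mulr_ge0 // ltW.
split; [|exact: exprn_ge0|].
  by rewrite mulr_gt0 ?exprn_gt0 // ltr_wpDl ?mulr_ge0.
apply: exprn_cross_le low_high => //.
- by rewrite addr_ge0 ?mulr_ge0.
- by rewrite ltr_wpDl.
- exact: ltW.
- by rewrite -subr_le0 ratio_cross mulr_ge0_le0 ?subr_ge0 ?subr_le0 // ltW.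
Qed.

Lemma high_to_low z0 z1 : high_phase z0 z1 ->
  low_phase (lambda * (beta * z0 + z1) ^+ b) ((z0 + gamma * z1) ^+ b).
Proof.
case: antiferro => beta0 _ gamma0 bg1 lambda0 [z00 z10 zq].
have q0 : 0 <= q by rewrite ltW // (le_lt_trans p0).
have y0 : 0 <= beta * z0 + z1 by rewrite addr_ge0 ?mulr_ge0 // ltW.
split; [by rewrite mulr_ge0 ?exprn_ge0 // ltW| |].
  by rewrite exprn_gt0 // ltr_pwDl ?mulr_ge0 // ltW.
apply: exprn_cross_le high_low => //.
- by rewrite addr_ge0 // ltW.
- by rewrite ltr_wpDl ?mulr_ge0.
- by rewrite -subr_ge0 ratio_cross mulr_ge0 ?subr_ge0 // ltW.
Qed.

Local Notation Z n := (root_weight beta gamma lambda (full_tree b n) n).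

Lemma full_tree_phases n : exists j,
  high_phase (Z n j false) (Z n j true) /\
  low_phase (Z n (~~ j) false) (Z n (~~ j) true).
Proof.
elim: n => [|n [j [high low]]].
  case: antiferro => _ _ _ _ lambda0; exists false; rewrite !root_weight_point /=.
  by split; split; rewrite ?mulr0 ?mulr1 // ltW.
exists (~~ j); rewrite negbK !root_weight_graft card_ord /= !mul1r.
by split; [exact: low_to_high|exact: high_to_low].
Qed.

Lemma low_phase_fraction z0 z1 : low_phase z0 z1 -> z0 / (z0 + z1) <= p / (p + 1).
Proof.
case=> z00 z10 zp; rewrite ler_pdivrMr ?ltr_wpDl // mulrAC ler_pdivlMr ?ltr_wpDl //.
by rewrite mulrDr mulr1 mulrDr mulrC lerD2l.
Qed.

Lemma high_phase_fraction z0 z1 : high_phase z0 z1 -> q / (q + 1) <= z0 / (z0 + z1).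
Proof.
have q0 : 0 < q by exact: le_lt_trans pq.
case=> z00 z10 qz; rewrite ler_pdivrMr ?addr_gt0 // mulrAC ler_pdivlMr ?ltr_pwDl //.
by rewrite mulrDr mulrDr mulr1 mulrC lerD2l.
Qed.

End Phases.

Lemma not_strong_spatial_mixing (R : realType) (beta gamma lambda gap : R)
    (F : sgraph -> Prop) : 0 < gap ->
  (forall n : nat, exists (G : sgraph) (v : G) (L : {set G}) (s t : config G),
     [/\ F G, 0 < prob beta gamma lambda (agree L s),
         0 < prob beta gamma lambda (agree L t),
         forall k, dist v (discrepancy L s t) = Some k -> (n <= k)%N
       & gap <= `|marginal0 beta gamma lambda v L s
                  - marginal0 beta gamma lambda v L t|]) ->
  ~ strong_spatial_mixing beta gamma lambda F.
Proof.
move=> gap0 far [C [c [C0 c0 mixing]]].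
suff : gap <= 0 by rewrite leNgt gap0.
apply: (expR_decay_le0 c0 C0) => n.
have [G [v [L [s [t [FG s0 t0 n_le le_gap]]]]]] := far n.
apply: le_trans le_gap (le_trans (mixing G FG v L s t s0 t0) _).
by rewrite ler_pM2l // decay_le.
Qed.

Theorem bounded_degree_not_mixing (R : realType) (beta gamma lambda p q : R)
    (b d : nat) :
  antiferromagnetic beta gamma lambda -> 0 <= p -> p < q ->
  q * (p + gamma) ^+ b <= lambda * (beta * p + 1) ^+ b ->
  lambda * (beta * q + 1) ^+ b <= p * (q + gamma) ^+ b ->
  (b < d)%N -> ~ strong_spatial_mixing beta gamma lambda (max_degree_le d).
Proof.
move=> antiferro p0 pq low_high high_low bd.
have [beta0 _ gamma0 _ lambda0] := antiferro.
apply: (@not_strong_spatial_mixing _ _ _ _ (q / (q + 1) - p / (p + 1))) => [|n].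
  rewrite subr_gt0 ltr_pdivrMr ?ltr_wpDl // mulrAC ltr_pdivlMr; last first.
    by rewrite ltr_wpDl // ltW // (le_lt_trans p0).
  by rewrite !mulrDr !mulr1 mulrC ltrD2l.
have [j [high low]] := full_tree_phases antiferro p0 pq low_high high_low n.
exists (full_tree b n), (root _), (level _ n), [ffun=> j], [ffun=> ~~ j].
have [[high0 high1 _] [low0 low1 _]] := (high, low).
split.
- by move=> u; apply: leq_trans bd; exact: (degree_full_tree b n).2.
- by rewrite prob_level_gt0 // ltr_pwDl.
- by rewrite prob_level_gt0 // ltr_wpDl.
- by move=> k; apply: dist_root_level; apply/subsetP => u; rewrite inE => /andP[].
rewrite !marginal0_root //; apply: le_trans (ler_norm _).
apply: lerB; first exact: (high_phase_fraction p0 pq high).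
exact: (low_phase_fraction p0 low).
Qed.

Theorem theorem8 (R : realType) :
  exists (beta gamma lambda : R) (d : nat),
    [/\ antiferromagnetic beta gamma lambda,
        (2 <= d)%N,
        strong_spatial_mixing beta gamma lambda (regular_tree_balls d) &
        ~ strong_spatial_mixing beta gamma lambda (max_degree_le d)].
Proof.
(* With gamma = 64 and lambda = 16 * gamma ^ 3, the influence bound in degree 4 is
   64 / (16 + gamma), and [p = gamma], [q = 4 * gamma] solve
   q * (p + gamma) ^ 2 = lambda. *)
have antiferro : antiferromagnetic 0 64 (16 * 64 ^+ 3 : R).
  by split; rewrite ?mul0r // mulr_gt0 // exprn_gt0.
exists 0, 64, (16 * 64 ^+ 3), 4%N; split=> //.
  by apply: regular_tree_mixing => //; lra.
by apply: (bounded_degree_not_mixing (p := 64) (q := 4 * 64) (b := 2)) => //; lra.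
Qed.
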